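(* Let $a_1,\dots,a_n\in\mathbb{R}^d$, let $\phi_1,\dots,\phi_n:\mathbb{R}\to\mathbb{R}$ be twice differentiable convex functions with $\phi_i''(t)>0$ for all $t$, and let $R(w)=\sum_{l=1}^dR_l(w_l)$ where each $R_l:\mathbb{R}\to\mathbb{R}$ is twice differentiable convex with $R_l''(t)>0$ for all $t\in\mathbb{R}$. Let $f_i(w)=\phi_i(\langle a_i,w\rangle)+R(w)$ for $i=1,\dots,n$. Then, for any $\pi\in(0,1)$ and $\gamma\in(0,1]$, the SAN algorithm applied to $f_1,\dots,f_n$ is the algorithm ''SAN for regularized GLMs'' (both described in the context): started from the same $w^0,\alpha_1^0,\dots,\alpha_n^0\in\mathbb{R}^d$ and with the same random choices, they produce the same iterates $w^k,\alpha_1^k,\dots,\alpha_n^k$.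
   Context: SAN with parameters $\pi,\gamma$: at each iteration $k$, with probability $\pi$: $\alpha_i^{k+1}=\alpha_i^k-\frac\gamma n\sum_{j=1}^n\alpha_j^k$ for all $i$, and $w^{k+1}=w^k$. Otherwise (with probability $1-\pi$): sample $j\in\{1,\dots,n\}$ uniformly, set $d^k=-(\mathbf{I}_d+\nabla^2f_j(w^k))^{-1}(\nabla f_j(w^k)-\alpha_j^k)$, $w^{k+1}=w^k+\gamma d^k$, $\alpha_j^{k+1}=\alpha_j^k-\gamma d^k$, $\alpha_i^{k+1}=\alpha_i^k$ for $i\neq j$. SAN for regularized GLMs with parameters $\pi,\gamma$: initialize $\overline\alpha^0=\frac1n\sum_{i=1}^n\alpha_i^0$. At each iteration $k$, with probability $\pi$: $\alpha_i^{k+1}=\alpha_i^k-\gamma\overline\alpha^k$ for all $i$, $w^{k+1}=w^k$, $\overline\alpha^{k+1}=(1-\gamma)\overline\alpha^k$. Otherwise (with probability $1-\pi$): sample $j\in\{1,\dots,n\}$ uniformly and set $$g^k=\nabla R(w^k)+\phi_j'(\langle a_j,w^k\rangle)a_j-\alpha_j^k,\qquad \hat a_j=(\mathbf{I}_d+\nabla^2R(w^k))^{-1}a_j,$$ $$d^k=\frac{\phi_j''(\langle a_j,w^k\rangle)\langle\hat a_j,g^k\rangle}{1+\phi_j''(\langle a_j,w^k\rangle)\langle\hat a_j,a_j\rangle}\hat a_j-(\mathbf{I}_d+\nabla^2R(w^k))^{-1}g^k,$$ $w^{k+1}=w^k+\gamma d^k$, $\alpha_j^{k+1}=\alpha_j^k-\gamma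 d^k$, $\alpha_i^{k+1}=\alpha_i^k$ for $i\ne j$, $\overline\alpha^{k+1}=\overline\alpha^k-\frac\gamma n d^k$. *)

(* Defs.v *)
From HB Require Import structures.
From mathcomp Require Import all_boot all_order all_algebra.
From mathcomp Require Import all_classical all_reals all_analysis.

Set Implicit Arguments.
Unset Strict Implicit.
Unset Printing Implicit Defensive.

Import Order.TTheory GRing.Theory Num.Theory.
Import numFieldNormedType.Exports.

Local Open Scope ring_scope.
Local Open Scope classical_set_scope.

Section Calculus.
Context {R : realType}.

Definition dot (d : nat) (u v : 'cV[R]_d) : R := \sum_(l < d) u l 0 * v l 0.

Definition basis_vec (d : nat) (l : 'I_d) : 'cV[R]_d := delta_mx l 0.

Definition grad (d : nat) (f : 'cV[R]_d -> R) (w : 'cV[R]_d) : 'cV[R]_d :=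
  \col_(l < d) 'D_(basis_vec l) f w.

Definition hessian (d : nat) (f : 'cV[R]_d -> R) (w : 'cV[R]_d) : 'M[R]_d :=
  \matrix_(k < d, l < d) 'D_(basis_vec k) ('D_(basis_vec l) f) w.

Definition twice_derivable (h : R -> R) : Prop :=
  forall t : R, derivable h t 1 /\ derivable h^`() t 1.

Definition convex_on_line (h : R -> R) : Prop :=
  convex_function ([set: R^o]) h.

End Calculus.

Section RandomChoices.
Context {R : realType}.

(* [c k] is the random choice made at iteration [k]: [None] stands for the
   averaging step, and [Some j] for the step on the function of index [j].
   Choosing [None] with probability [pi], and otherwise drawing [j] uniformly,
   gives each [Some j] the probability [(1 - pi) / n]. *)
Structure san_choices (disp : measure_display) (Omega : measurableType disp)
    (P : probability Omega R) (n : nat) (pi : R)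
    (c : nat -> Omega -> option 'I_n) : Prop := SanChoices {
  choices_measurable : forall (k : nat) (A : set (option 'I_n)),
    measurable (c k @^-1` A) ;
  choices_average : forall k : nat, P (c k @^-1` [set None]) = pi%:E ;
  choices_sample : forall (k : nat) (j : 'I_n),
    P (c k @^-1` [set Some j]) = ((1 - pi) / n%:R)%:E ;
  choices_independent : forall (K : seq nat) (A : nat -> set (option 'I_n)),
    uniq K ->
    P (\bigcap_(k in [set` K]) (c k @^-1` A k)) =
      (\prod_(k <- K) P (c k @^-1` A k))%E
}.

End RandomChoices.

Section SAN.
Context {R : realType} {n d : nat}.

Record san_state := SanState {
  san_w : 'cV[R]_d ;
  san_alpha : 'I_n -> 'cV[R]_d
}.

(* [invmx] returns its argument unchanged when it is singular; for convex [f j]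
   the matrix below is positive definite, hence invertible. *)
Definition san_direction (f : 'I_n -> 'cV[R]_d -> R) (s : san_state)
    (j : 'I_n) : 'cV[R]_d :=
  - (invmx (1%:M + hessian (f j) (san_w s))
       *m (grad (f j) (san_w s) - san_alpha s j)).

Definition san_step (gamma : R) (f : 'I_n -> 'cV[R]_d -> R) (s : san_state)
    (choice : option 'I_n) : san_state :=
  match choice with
  | None =>
      SanState (san_w s)
        (fun i => san_alpha s i
                  - (gamma / n%:R) *: \sum_(j < n) san_alpha s j)
  | Some j =>
      let dk := san_direction f s j in
      SanState (san_w s + gamma *: dk)
        (fun i => if i == j then san_alpha s j - gamma *: dk
                  else san_alpha s i)
  end.

Fixpoint san (gamma : R) (f : 'I_n -> 'cV[R]_d -> R)
    (w0 : 'cV[R]_d) (alpha0 : 'I_n -> 'cV[R]_d)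
    (choice : nat -> option 'I_n) (k : nat) : san_state :=
  match k with
  | 0%N => SanState w0 alpha0
  | k'.+1 => san_step gamma f (san gamma f w0 alpha0 choice k') (choice k')
  end.

End SAN.

Section SANGLM.
Context {R : realType} {n d : nat}.

Definition separable (r : 'I_d -> R -> R) (w : 'cV[R]_d) : R :=
  \sum_(l < d) r l (w l 0).

Definition glm_loss (a : 'I_n -> 'cV[R]_d) (phi : 'I_n -> R -> R)
    (reg : 'cV[R]_d -> R) (i : 'I_n) (w : 'cV[R]_d) : R :=
  phi i (dot (a i) w) + reg w.

Record glm_state := GlmState {
  glm_w : 'cV[R]_d ;
  glm_alpha : 'I_n -> 'cV[R]_d ;
  glm_alphabar : 'cV[R]_d
}.

Definition glm_direction (a : 'I_n -> 'cV[R]_d) (phi : 'I_n -> R -> R)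
    (reg : 'cV[R]_d -> R) (s : glm_state) (j : 'I_n) : 'cV[R]_d :=
  let w := glm_w s in
  let t := dot (a j) w in
  let phi1 := (phi j)^`() t in
  let phi2 := (phi j)^`(2) t in
  let H := invmx (1%:M + hessian reg w) in
  let g := grad reg w + phi1 *: a j - glm_alpha s j in
  let ahat := H *m a j in
  (phi2 * dot ahat g / (1 + phi2 * dot ahat (a j))) *: ahat - H *m g.

Definition glm_step (gamma : R) (a : 'I_n -> 'cV[R]_d) (phi : 'I_n -> R -> R)
    (reg : 'cV[R]_d -> R) (s : glm_state) (choice : option 'I_n) : glm_state :=
  match choice with
  | None =>
      GlmState (glm_w s)
        (fun i => glm_alpha s i - gamma *: glm_alphabar s)
        ((1 - gamma) *: glm_alphabar s)
  | Some j =>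
      let dk := glm_direction a phi reg s j in
      GlmState (glm_w s + gamma *: dk)
        (fun i => if i == j then glm_alpha s j - gamma *: dk
                  else glm_alpha s i)
        (glm_alphabar s - (gamma / n%:R) *: dk)
  end.

Fixpoint san_glm (gamma : R) (a : 'I_n -> 'cV[R]_d) (phi : 'I_n -> R -> R)
    (reg : 'cV[R]_d -> R) (w0 : 'cV[R]_d) (alpha0 : 'I_n -> 'cV[R]_d)
    (choice : nat -> option 'I_n) (k : nat) : glm_state :=
  match k with
  | 0%N => GlmState w0 alpha0 (n%:R^-1 *: \sum_(i < n) alpha0 i)
  | k'.+1 => glm_step gamma a phi reg
               (san_glm gamma a phi reg w0 alpha0 choice k') (choice k')
  end.

End SANGLM.

(* Main.v *)
(** The Hessian of [f_j] at [w] is [hessian R w + phi_j''(<a_j, w>) a_j a_j^T], and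
    [I + hessian R w] is diagonal with entries at least 1.  The GLM direction is the
    Sherman-Morrison formula for this rank-one update; by induction on [k],
    [alphabar^k] stays the mean of the [alpha_i^k], so the averaging steps agree
    as well. *)

Require Import Defs.
From mathcomp Require Import all_boot all_order all_algebra.
From mathcomp Require Import all_classical all_reals all_analysis.
From mathcomp Require Import ring.
Import Order.TTheory GRing.Theory Num.Theory.
Import numFieldNormedType.Exports.
Local Open Scope ring_scope.
Local Open Scope classical_set_scope.

Set Implicit Arguments.
Unset Strict Implicit.
Unset Printing Implicit Defensive.

(** * Inverse of a symmetric matrix after a rank-one update *)

Section RankOneUpdate.
Context {R : realType} {d : nat}.
Implicit Types (A : 'M[R]_d) (u v w : 'cV[R]_d).

Lemma trmx_mul_dot u v : u^T *m v = (dot u v)%:M.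
Proof.
apply/matrixP => i j; rewrite !ord1 !mxE eqxx mulr1n.
by apply: eq_bigr => l _; rewrite mxE.
Qed.

Lemma dot_mulmxl A u v : A^T = A -> dot (A *m u) v = dot u (A *m v).
Proof.
move=> Asym; have := trmx_mul_dot (A *m u) v.
rewrite trmx_mul Asym -mulmxA trmx_mul_dot => /matrixP /(_ 0 0).
by rewrite !mxE eqxx !mulr1n.
Qed.

Lemma rank_one_mul u v w : (u *m v^T) *m w = dot v w *: u.
Proof. by rewrite -mulmxA trmx_mul_dot mul_mx_scalar. Qed.

(** Symmetry of [A] turns the row [u^T *m invmx A] into [u'^T], so the usual correction term is a
    multiple of [u' *m u'^T] and every scalar is a dot product with [u']. *)
Lemma sherman_morrison A (b : R) u g :
  A \in unitmx -> A^T = A ->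
  let u' := invmx A *m u in
  1 + b * dot u' u != 0 ->
  invmx (A + b *: (u *m u^T)) *m g =
    invmx A *m g - (b * dot u' g / (1 + b * dot u' u)) *: u'.
Proof.
move=> Au Asym u' den0; set q := 1 + b * dot u' u.
have u'A v : dot u (invmx A *m v) = dot u' v.
  by rewrite /u' dot_mulmxl // trmx_inv Asym.
have AK v : A *m (invmx A *m v) = v by rewrite mulKVmx.
pose B := invmx A - (b / q) *: (u' *m u'^T).
have Bg v : B *m v = invmx A *m v - (b * dot u' v / q) *: u'.
  by rewrite mulmxBl -scalemxAl rank_one_mul scalerA mulrAC.
(* Everything beyond [v] is a multiple of [u], with coefficient [b * dot u' v * (1 - (1 + b * dot u'
   u) / q)], which is zero by the choice of [q]. *)
have inv_mul v : (A + b *: (u *m u^T)) *m (B *m v) = v.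
  rewrite Bg mulmxDl !mulmxBr -!scalemxAr -!scalemxAl AK /u' AK !rank_one_mul.
  rewrite !u'A !scalerA -addrA -[RHS]addr0; congr (_ + _).
  rewrite -scalerBl -scaleNr -scalerDl; apply/eqP; rewrite scaler_eq0.
  apply/orP; left; apply/eqP.
  by rewrite -/u' /q; field.
(* Columns are images of basis vectors, so the action on vectors determines the product. For square
   matrices this right inverse makes the updated matrix a unit. *)
have MB : (A + b *: (u *m u^T)) *m B = 1%:M.
  apply/trmx_inj/row_matrixP => i.
  by rewrite -!tr_col !colE -mulmxA inv_mul mul1mx.
have [Mu _] := mulmx1_unit MB.
by rewrite -Bg; apply: (can_inj (mulKmx Mu)); rewrite inv_mul mulKVmx.
Qed.

End RankOneUpdate.

(** * Directional derivatives of ridge functions and of separable sums *)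

Section SeparableRidge.
Context {R : realType} {d : nat}.
Implicit Types (b v w : 'cV[R]_d) (h : R -> R).

Lemma dotC b v : dot b v = dot v b.
Proof. by apply: eq_bigr => l _; rewrite mulrC. Qed.

Lemma dot_basisr b (l : 'I_d) : dot b (basis_vec l) = b l 0.
Proof.
rewrite /dot (bigD1 l) //= big1 ?addr0 => [|i /negPf il]; rewrite !mxE.
  by rewrite !eqxx mulr1.
by rewrite il mulr0.
Qed.

Lemma dotDr b v w : dot b (v + w) = dot b v + dot b w.
Proof. by rewrite -big_split; apply: eq_bigr => l _; rewrite mxE mulrDr. Qed.

Lemma dotZr b (x : R) v : dot b (x *: v) = x * dot b v.
Proof. by rewrite mulr_sumr; apply: eq_bigr => l _; rewrite mxE mulrCA. Qed.

(* Along the line [w + x v] the function is [h] of an affine function of [x]. *)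
Lemma is_derive_ridge h b w v :
  derivable h (dot b w) 1 ->
  is_derive w v (fun x => h (dot b x)) (h^`()%classic (dot b w) * dot b v).
Proof.
move=> hd; pose aff (x : R) : R := x * dot b v + dot b w.
have line : (fun x : R => h (dot b (x *: v + w))) = h \o aff.
  by apply/funext => x /=; rewrite dotDr dotZr.
have daff : is_derive (0 : R) 1 aff (dot b v).
  have := is_deriveD (is_deriveM (is_derive_id (0 : R) 1)
    (is_derive_cst (dot b v) (0 : R) 1)) (is_derive_cst (dot b w) (0 : R) 1).
  by rewrite scaler0 add0r addr0 /= /GRing.scale /= mulr1.
have dcomp : is_derive (0 : R) 1 (h \o aff) (h^`()%classic (dot b w) * dot b v).
  apply: (is_derive1_comp _ daff); rewrite /aff mul0r add0r derive1E.
  exact: derivableP.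
apply: DeriveDef; first
  by apply/derivable1P; rewrite line; exact: (@ex_derive _ _ _ _ _ _ _ dcomp).
rewrite -(@derive_val _ _ _ _ _ _ _ dcomp) -line /derive.
(* These are the difference quotients at [w] along [v] and at [0] on the line; they differ only by
   trivial terms such as [0 *: v]. *)
set p := fun x : R => x^-1 *: _; set q := fun x : R => x^-1 *: _.
suff -> : p = q by [].
by apply/funext => x; rewrite /p /q /= scale0r add0r addr0 [x%:A]mulr1.
Qed.

Section Separable.
Variable r : 'I_d -> R -> R.
Hypothesis r_twice : forall l, twice_derivable (r l).

(** A coordinate is the dot product with a basis vector, so [separable r] is a sum of ridge
    functions, and only the [l]-th one varies along [basis_vec l]. *)
Lemma is_derive_separable w (l : 'I_d) :
  is_derive w (basis_vec l) (separable r) ((r l)^`()%classic (w l 0)).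
Proof.
have -> : separable r = \sum_(i < d) (fun x => r i (dot (basis_vec i) x)).
  apply/funext => x; rewrite fct_sumE.
  by apply: eq_bigr => i _; rewrite dotC dot_basisr.
have dr i : is_derive w (basis_vec l) (fun x => r i (dot (basis_vec i) x))
    ((r i)^`()%classic (w i 0) * dot (basis_vec i) (basis_vec l)).
  rewrite -[w i 0]dot_basisr dotC; apply: is_derive_ridge.
  by have [] := r_twice i (dot (basis_vec i) w).
apply: is_derive_eq (is_derive_sum dr) _.
rewrite (bigD1 l) //= dot_basisr mxE !eqxx mulr1 big1 ?addr0 // => i il.
by rewrite dot_basisr mxE eq_sym (negPf il) mulr0.
Qed.

Lemma derive_separable (l : 'I_d) w :
  'D_(basis_vec l) (separable r) w = (r l)^`()%classic (w l 0).
Proof. by have [_] := is_derive_separable w l. Qed.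

(** The [l]-th partial derivative is again a ridge function along [basis_vec l], so the same rule
    applies once more. *)
Lemma is_derive2_separable w (k l : 'I_d) :
  is_derive w (basis_vec k) (fun x : 'cV[R]_d => (r l)^`()%classic (x l 0))
    ((r l)^`(2)%classic (w l 0) *+ (k == l)).
Proof.
have -> : (fun x : 'cV[R]_d => (r l)^`()%classic (x l 0)) =
    fun x => (r l)^`()%classic (dot (basis_vec l) x).
  by apply/funext => x; rewrite dotC dot_basisr.
have -> : (r l)^`(2)%classic (w l 0) *+ (k == l) =
    (r l)^`()^`()%classic (dot (basis_vec l) w) * dot (basis_vec l) (basis_vec k).
  by rewrite dot_basisr mxE eqxx andbT dotC dot_basisr mulr_natr.
by apply: is_derive_ridge; have [] := r_twice l (dot (basis_vec l) w).
Qed.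

Lemma hessian_separable w :
  hessian (separable r) w = diag_mx (\row_l (r l)^`(2)%classic (w l 0)).
Proof.
apply/matrixP => k l; rewrite !mxE (funext (derive_separable l)).
have [_ ->] := is_derive2_separable w k l.
by case: (eqVneq k l) => [->//|_]; rewrite [LHS]mulr0n [RHS]mulr0n.
Qed.

(** * Gradient and Hessian of the regularized losses *)

Section Glm.
Variables (n : nat) (a : 'I_n -> 'cV[R]_d) (phi : 'I_n -> R -> R).
Hypothesis phi_twice : forall i, twice_derivable (phi i).

Let f := glm_loss a phi (separable r).

Lemma derive_glm_loss (i : 'I_n) (l : 'I_d) w :
  'D_(basis_vec l) (f i) w =
    (phi i)^`()%classic (dot (a i) w) * a i l 0 + (r l)^`()%classic (w l 0).
Proof.
rewrite -[a i l 0]dot_basisr.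
have [dphi _] := phi_twice i (dot (a i) w).
by have [_] := is_deriveD (is_derive_ridge _ dphi) (is_derive_separable w l).
Qed.

Lemma grad_glm_loss (i : 'I_n) w :
  grad (f i) w =
    grad (separable r) w + (phi i)^`()%classic (dot (a i) w) *: a i.
Proof.
apply/matrixP => l j; rewrite !ord1 !mxE derive_glm_loss derive_separable.
by rewrite addrC.
Qed.

Lemma hessian_glm_loss (i : 'I_n) w :
  hessian (f i) w = hessian (separable r) w
    + (phi i)^`(2)%classic (dot (a i) w) *: (a i *m (a i)^T).
Proof.
apply/matrixP => k l; rewrite !mxE.
rewrite (funext (derive_glm_loss i l)) (funext (derive_separable l)).
have [_ dphi] := phi_twice i (dot (a i) w).
have dr := is_derive2_separable w k l.
(* The entry [a i l 0] is a constant factor, so one term of the product rule vanishes. *)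
have [_ ->] := is_deriveD (is_deriveM (is_derive_ridge _ dphi)
  (is_derive_cst (a i l 0) w (basis_vec k))) dr.
have [_ ->] := dr.
rewrite addrC scaler0 add0r dot_basisr big_ord1 !mxE /=; congr (_ + _).
by rewrite /GRing.scale /=; ring.
Qed.

End Glm.
End Separable.
End SeparableRidge.

(** * Equality of the directions and of the iterates *)

Section Directions.
Context {R : realType} {n d : nat}.
Variables (a : 'I_n -> 'cV[R]_d) (phi : 'I_n -> R -> R) (r : 'I_d -> R -> R).
Hypothesis phi_twice : forall i, twice_derivable (phi i).
Hypothesis phi_ge0 : forall i t, 0 <= (phi i)^`(2)%classic t.
Hypothesis r_twice : forall l, twice_derivable (r l).
Hypothesis r_ge0 : forall l t, 0 <= (r l)^`(2)%classic t.

Let reg := separable r.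

Lemma one_plus_hessian_diag (w : 'cV[R]_d) :
  1%:M + hessian reg w = diag_mx (\row_l (1 + (r l)^`(2)%classic (w l 0))).
Proof.
rewrite hessian_separable //.
by apply/matrixP => k l; rewrite !mxE -mulrnDl.
Qed.

(** The diagonal entries are at least 1, so [invmx] is a genuine inverse here and not its default
    value on singular matrices. *)
Lemma invmx_one_plus_hessian (w : 'cV[R]_d) :
  1%:M + hessian reg w \in unitmx /\
  invmx (1%:M + hessian reg w) =
    diag_mx (\row_l (1 + (r l)^`(2)%classic (w l 0))^-1).
Proof.
rewrite one_plus_hessian_diag; set D := diag_mx _; set E := diag_mx _.
have DE : D *m E = 1%:M.
  rewrite mulmx_diag -diag_const_mx; congr diag_mx.
  apply/matrixP => i l; rewrite !mxE mulfV //.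
  by rewrite gt_eqF // ltr_wpDr.
have [Du _] := mulmx1_unit DE; split => //.
by rewrite -[LHS]mulmx1 -DE mulKmx.
Qed.

(** A sum of squares with nonnegative weights; it keeps the Sherman-Morrison denominator at least
    1. *)
Lemma dot_invmx_ge0 (w u : 'cV[R]_d) :
  0 <= dot (invmx (1%:M + hessian reg w) *m u) u.
Proof.
have [_ ->] := invmx_one_plus_hessian w.
rewrite mul_diag_mx; apply: sumr_ge0 => l _; rewrite !mxE -mulrA.
by rewrite mulr_ge0 // ?invr_ge0 ?addr_ge0 // -expr2 sqr_ge0.
Qed.

Lemma san_direction_glm (s : san_state) (t : glm_state) (j : 'I_n) :
  san_w s = glm_w t -> san_alpha s j = glm_alpha t j ->
  san_direction (glm_loss a phi reg) s j = glm_direction a phi reg t j.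
Proof.
move=> sw sa; rewrite /san_direction /glm_direction sw sa.
rewrite hessian_glm_loss // grad_glm_loss // -/reg addrA.
set w := glm_w t.
have [Hu _] := invmx_one_plus_hessian w.
rewrite sherman_morrison //; first by rewrite opprB.
  by rewrite one_plus_hessian_diag tr_diag_mx.
by rewrite gt_eqF // ltr_wpDr // mulr_ge0 // dot_invmx_ge0.
Qed.

Lemma san_glm_invariant (gamma : R) (w0 : 'cV[R]_d) (alpha0 : 'I_n -> 'cV[R]_d)
    (choice : nat -> option 'I_n) (k : nat) :
  let x := san gamma (glm_loss a phi reg) w0 alpha0 choice k in
  let y := san_glm gamma a phi reg w0 alpha0 choice k in
  [/\ san_w x = glm_w y,
      forall i, san_alpha x i = glm_alpha y i
    & glm_alphabar y = n%:R^-1 *: \sum_(i < n) glm_alpha y i].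
Proof.
move=> x y; rewrite {}/x {}/y; elim: k => [//|k] /=.
set x := san _ _ _ _ _ k; set y := san_glm _ _ _ _ _ _ _ k.
move=> [xyw xya ybar]; case: (choice k) => [j|] /=.
  rewrite (san_direction_glm xyw (xya j)); move: (glm_direction _ _ _ _ _) => dk.
  split=> [|i|]; rewrite ?xyw ?xya //.
  (* Only the [j]-th summand moves, so the mean moves by [gamma / n] times [dk]. *)
  have -> : \sum_(i < n) (if i == j then glm_alpha y j - gamma *: dk
      else glm_alpha y i) = \sum_(i < n) glm_alpha y i - gamma *: dk.
    rewrite (bigD1 j) //= eqxx [in RHS](bigD1 j) //= addrAC; congr (_ + _ - _).
    by apply: eq_bigr => i /negPf ->.
  by rewrite scalerBr -ybar scalerA [gamma / _]mulrC.
split=> [//|i|].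
  rewrite xya ybar scalerA; congr (_ - _ *: _).
  by apply: eq_bigr.
rewrite sumrB scalerBr -ybar sumr_const card_ord scalerBl scale1r.
congr (_ - _); rewrite -[(_ *: _) *+ n]scaler_nat [RHS]scalerA.
(* For [n = 0] the inverse [n%:R^-1] is [0], hence [alphabar] is [0] and both sides vanish;
   otherwise [n] equal summands cancel it. *)
case: (posnP n) => [n0|n0].
  rewrite ybar.
  have -> : n%:R^-1 = 0 :> R by rewrite n0 invr0.
  by rewrite scale0r !scaler0.
by rewrite mulVf ?scale1r // pnatr_eq0 -lt0n.
Qed.

End Directions.

Unset Implicit Arguments.

Theorem lemmaB4 (R : realType) (n d : nat)
  (a : 'I_n -> 'cV[R]_d) (phi : 'I_n -> R -> R) (r : 'I_d -> R -> R)
  (phi_twice : forall i : 'I_n, twice_derivable (phi i))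
  (phi_convex : forall i : 'I_n, convex_on_line (phi i))
  (phi_pos : forall (i : 'I_n) (t : R), 0 < (phi i)^`(2) t)
  (r_twice : forall l : 'I_d, twice_derivable (r l))
  (r_convex : forall l : 'I_d, convex_on_line (r l))
  (r_pos : forall (l : 'I_d) (t : R), 0 < (r l)^`(2) t)
  (pi gamma : R)
  (pi_range : 0 < pi < 1) (gamma_range : 0 < gamma <= 1)
  (disp : measure_display) (Omega : measurableType disp)
  (P : probability Omega R) (c : nat -> Omega -> option 'I_n)
  (c_choices : san_choices P pi c)
  (w0 : 'cV[R]_d) (alpha0 : 'I_n -> 'cV[R]_d) (omega : Omega) (k : nat) :
  let reg := separable r in
  let f := glm_loss a phi reg in
  let x := san gamma f w0 alpha0 (fun m => c m omega) k in
  let y := san_glm gamma a phi reg w0 alpha0 (fun m => c m omega) k in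
  san_w x = glm_w y /\ forall i : 'I_n, san_alpha x i = glm_alpha y i.
Proof.
move=> reg f x y.
have phi_ge0 i t : 0 <= (phi i)^`(2) t by exact: ltW.
have r_ge0 l t : 0 <= (r l)^`(2) t by exact: ltW.
(* The argument is pathwise: [omega] fixes one sequence of choices shared by both algorithms. *)
by have [] := san_glm_invariant a phi_twice phi_ge0 r_twice r_ge0 gamma w0 alpha0
  (fun m => c m omega) k.
Qed.
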